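(* Let $G$ be a finite simple graph such that no induced subgraph of $G$ is isomorphic to the four-edge path $P_5$ (the path on five vertices), and no induced subgraph of $G$ is isomorphic to the complement of the four-edge path. Then $G$ is $2$-narrow; that is, for every function $f: V(G) \to [0,1]$ such that $\sum_{v \in V(P)} f(v) \leq 1$ for every perfect induced subgraph $P$ of $G$, we have $\sum_{v \in V(G)} f(v)^2 \leq 1$.
   Context: All graphs are finite and simple. A graph $H$ is perfect if $\chi(H')=\omega(H')$ for every induced subgraph $H'$ of $H$, where $\chi$ denotes chromatic number and $\omega$ the maximum size of a clique. For a graph $G$, a function $f: V(G)\to[0,1]$ is called good if $\sum_{v\in V(P)} f(v)\le 1$ for every perfect induced subgraph $P$ of $G$; for $\alpha\ge 1$, $G$ is $\alpha$-narrow if $\sum_{v\in V(G)} f(v)^{\alpha}\le 1$ for every good function $f$. The complement of a graph has the same vertex set, with two vertices adjacent exactly when they are non-adjacent in the original graph. *)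

(* Defs.v *)
From HB Require Import structures.
From mathcomp Require Import all_boot all_order all_algebra.
From mathcomp Require Import reals exp.

Set Implicit Arguments.
Unset Strict Implicit.
Unset Printing Implicit Defensive.

Import Order.TTheory GRing.Theory Num.Theory.

Record sgraph := SGraph {
  vertex :> finType;
  adj : rel vertex;
  adj_sym : symmetric adj;
  adj_irrefl : irreflexive adj }.

Lemma induced_sym (G : sgraph) (S : {set G}) :
  symmetric (fun x y : {x : G | x \in S} => adj (val x) (val y)).
Proof. by move=> x y; rewrite adj_sym. Qed.

Lemma induced_irrefl (G : sgraph) (S : {set G}) :
  irreflexive (fun x y : {x : G | x \in S} => adj (val x) (val y)).
Proof. by move=> x; rewrite adj_irrefl. Qed.

Definition induced (G : sgraph) (S : {set G}) : sgraph :=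
  SGraph (@induced_sym G S) (@induced_irrefl G S).

Lemma complement_sym (G : sgraph) :
  symmetric (fun x y : G => (x != y) && ~~ adj x y).
Proof. by move=> x y; rewrite eq_sym adj_sym. Qed.

Lemma complement_irrefl (G : sgraph) :
  irreflexive (fun x y : G => (x != y) && ~~ adj x y).
Proof. by move=> x; rewrite eqxx. Qed.

Definition complement (G : sgraph) : sgraph :=
  SGraph (@complement_sym G) (@complement_irrefl G).

Lemma path_sym (n : nat) :
  symmetric (fun i j : 'I_n => (i.+1 == j :> nat) || (j.+1 == i :> nat)).
Proof. by move=> i j; rewrite orbC. Qed.

Lemma path_irrefl (n : nat) :
  irreflexive (fun i j : 'I_n => (i.+1 == j :> nat) || (j.+1 == i :> nat)).
Proof. by move=> i; rewrite orbb gtn_eqF. Qed.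

(* The index n counts vertices, so path_graph 5 has four edges. *)
Definition path_graph (n : nat) : sgraph :=
  SGraph (@path_sym n) (@path_irrefl n).

Definition isomorphic (G H : sgraph) : Prop :=
  exists2 f : G -> H, bijective f & {mono f : x y / adj x y}.

Definition induced_free (H G : sgraph) : Prop :=
  forall S : {set G}, ~ isomorphic (induced S) H.

Definition clique (G : sgraph) (A : {set G}) : bool :=
  [forall x in A, forall y in A, (x != y) ==> adj x y].

Definition clique_number (G : sgraph) : nat :=
  \max_(A : {set G} | clique A) #|A|.

Definition colorable (G : sgraph) (k : nat) : bool :=
  [exists c : {ffun G -> 'I_k}, forall x, forall y, adj x y ==> (c x != c y)].

Lemma colorable_ex (G : sgraph) : exists k, colorable G k.
Proof.
exists #|G|; apply/existsP; exists [ffun x => enum_rank x].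
apply/forallP => x; apply/forallP => y; apply/implyP => xy.
rewrite !ffunE (inj_eq enum_rank_inj); apply: contraTneq xy => ->.
by rewrite adj_irrefl.
Qed.

Definition chromatic_number (G : sgraph) : nat := ex_minn (colorable_ex G).

Definition perfect (G : sgraph) : Prop :=
  forall S : {set G},
    chromatic_number (induced S) = clique_number (induced S).

Local Open Scope ring_scope.

Definition good (R : realType) (G : sgraph) (f : G -> R) : Prop :=
  (forall v, 0 <= f v <= 1) /\
  (forall P : {set G}, perfect (induced P) -> \sum_(v in P) f v <= 1).

(* Meaningful for real exponents alpha >= 1; `^ is the real power, with
   0 `^ alpha = 0 for alpha != 0. *)
Definition narrow (R : realType) (alpha : R) (G : sgraph) : Prop :=
  forall f : G -> R, good f -> \sum_(v : G) f v `^ alpha <= 1.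

(* Main.v *)
(** The C5-free vertex sets of [G] induce perfect subgraphs, and only these are
    needed. If [f] has sum at most [m] on each C5-free subset of [U], then its sum
    of squares over [U] is at most [m ^+ 2], by induction on [#|U|]. If [U]
    contains a C5, then a maximal blow-up of that C5 shows that [U] has five
    vertices or has a nontrivial homogeneous set [X] (Fouquet). In the latter case
    contract [X] to a vertex whose weight is the largest sum of [f] on a C5-free
    subset of [X]; since C5 has no nontrivial homogeneous set, substituting a
    C5-free set for a vertex of a C5-free set gives a C5-free set.

    That a graph with no induced P5, house (the complement of P5) or C5 has
    chromatic number equal to its clique number is shown by induction: given a
    vertex [v], either [v] is universal, or there is a star cutset centred at [v],
    or a non-neighbour of [v] with most neighbours in [N(v)] dominates [v] and can
    lend [v] its colour. *)
Require Import Defs.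
From HB Require Import structures.
From mathcomp Require Import all_boot all_order all_algebra.
From mathcomp Require Import reals exp.
From mathcomp Require Import lra.

Set Implicit Arguments.
Unset Strict Implicit.
Unset Printing Implicit Defensive.

Import Order.TTheory GRing.Theory Num.Theory.

(** * The five-cycle, and induced patterns as maps *)

Definition c5adj (i j : 'I_5) : bool := (i.+1 %% 5 == j) || (j.+1 %% 5 == i).

Lemma c5adj_sym : symmetric c5adj.
Proof. by move=> i j; rewrite /c5adj orbC. Qed.

Lemma c5adj_irrefl : irreflexive c5adj.
Proof. by case=> [[|[|[|[|[|//]]]]] ?]. Qed.

Definition C5 : sgraph := SGraph c5adj_sym c5adj_irrefl.

(** Injectivity is not demanded of [f]; for a pattern without twins it is automatic, by
    [mono_inj]. *)
Definition mono_free (H G : sgraph) : Prop :=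
  forall f : H -> G, ~ {mono f : x y / adj x y}.

Definition point_determining (H : sgraph) : Prop :=
  forall x y : H, x != y -> exists z, adj x z != adj y z.

Lemma mono_inj (H G : sgraph) (f : H -> G) :
  point_determining H -> {mono f : x y / adj x y} -> injective f.
Proof.
move=> pdH fM x y fxy; apply/eqP; apply/negPn/negP => /pdH[z].
by rewrite -!fM fxy eqxx.
Qed.

(** As [H] has no twins, [f] is injective, and its inverse is an isomorphism from the subgraph
    induced by its image onto [H]. *)
Lemma induced_free_mono_free (H G : sgraph) :
  point_determining H -> induced_free H G -> mono_free H G.
Proof.
move=> pdH HG f fM; have fI := mono_inj pdH fM.
have fS x : f x \in f @: [set: H] by rewrite imset_f ?inE.
apply: (HG (f @: [set: H])).
have gex (s : induced (f @: [set: H])) : exists x, f x == val s.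
  by case: s => s /= /imsetP[x _ ->]; exists x.
pose g s := xchoose (gex s).
have gK s : f (g s) = val s by apply/eqP; exact: xchooseP (gex s).
exists g; last by move=> s t /=; rewrite -fM !gK.
exists (fun x => exist _ (f x) (fS x)) => [s|x]; first exact/val_inj/gK.
exact/fI/gK.
Qed.

Lemma mono_free_comp (H G K : sgraph) (g : G -> K) :
  {mono g : x y / adj x y} -> mono_free H K -> mono_free H G.
Proof. by move=> gM HK f fM; apply: (HK (g \o f)) => x y /=; rewrite gM fM. Qed.

Local Notation o5 k := (@Ordinal 5 k isT).

Ltac ord5 i := case: i => [[|[|[|[|[|//]]]]] ?].
Ltac ex5 := first [ by exists (o5 0) | by exists (o5 1) | by exists (o5 2)
                  | by exists (o5 3) | by exists (o5 4) ].

(** In contrast to the tactic [ord5], this yields the closed ordinals [o5 k], so that hypotheses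
    stated for these can rewrite the goal. *)
Lemma ord5_ind (P : 'I_5 -> Prop) :
  P (o5 0) -> P (o5 1) -> P (o5 2) -> P (o5 3) -> P (o5 4) -> forall i, P i.
Proof.
move=> P0 P1 P2 P3 P4 i.
have : i \in [:: o5 0; o5 1; o5 2; o5 3; o5 4] by rewrite !inE; ord5 i.
by rewrite !inE => /or4P[||| /orP[]] /eqP->.
Qed.

Lemma P5_point_determining : point_determining (path_graph 5).
Proof. by move=> i j; ord5 i; ord5 j => //= _; ex5. Qed.

Lemma coP5_point_determining : point_determining (complement (path_graph 5)).
Proof. by move=> i j; ord5 i; ord5 j => //= _; ex5. Qed.

Lemma C5_point_determining : point_determining C5.
Proof. by move=> i j; ord5 i; ord5 j => //= _; ex5. Qed.

Section Patterns.

Variable G : sgraph.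
Implicit Types a b c d e : G.

Let fam a b c d e (i : 'I_5) := nth a [:: a; b; c; d; e] i.

Lemma P5_freeP a b c d e : mono_free (path_graph 5) G ->
  adj a b -> adj b c -> adj c d -> adj d e ->
  ~~ adj a c -> ~~ adj a d -> ~~ adj a e -> ~~ adj b d -> ~~ adj b e ->
  ~~ adj c e -> False.
Proof.
move=> F ab bc cd de /negbTE ac /negbTE ad /negbTE ae /negbTE bd /negbTE be
  /negbTE ce.
apply: (F (fam a b c d e)) => i j; ord5 i; ord5 j => /=;
  by rewrite /fam /= ?adj_irrefl // ?(ab, bc, cd, de, ac, ad, ae, bd, be, ce) //
    adj_sym ?(ab, bc, cd, de, ac, ad, ae, bd, be, ce).
Qed.

Lemma house_freeP a b c d e : mono_free (complement (path_graph 5)) G ->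
  ~~ adj a b -> ~~ adj b c -> ~~ adj c d -> ~~ adj d e ->
  adj a c -> adj a d -> adj a e -> adj b d -> adj b e -> adj c e -> False.
Proof.
move=> F /negbTE ab /negbTE bc /negbTE cd /negbTE de ac ad ae bd be ce.
apply: (F (fam a b c d e)) => i j; ord5 i; ord5 j => /=;
  by rewrite /fam /= ?adj_irrefl // ?(ab, bc, cd, de, ac, ad, ae, bd, be, ce) //
    adj_sym ?(ab, bc, cd, de, ac, ad, ae, bd, be, ce).
Qed.

Lemma C5_freeP a b c d e : mono_free C5 G ->
  adj a b -> adj b c -> adj c d -> adj d e -> adj a e ->
  ~~ adj a c -> ~~ adj a d -> ~~ adj b d -> ~~ adj b e -> ~~ adj c e -> False.
Proof.
move=> F ab bc cd de ae /negbTE ac /negbTE ad /negbTE bd /negbTE be /negbTE ce.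
apply: (F (fam a b c d e)) => i j; ord5 i; ord5 j => /=;
  by rewrite /fam /= ?adj_irrefl // ?(ab, bc, cd, de, ac, ad, ae, bd, be, ce) //
    adj_sym ?(ab, bc, cd, de, ac, ad, ae, bd, be, ce).
Qed.

End Patterns.

(** * Colouring with as many colours as the clique number *)

Section Coloring.

Variable G : sgraph.
Implicit Types (U V W K : {set G}) (k : nat).

(** Colourings are total functions into [nat], so that they can be restricted, glued and extended by
    a new colour without a change of type. *)
Definition colorable_in U k : Prop :=
  exists2 c : G -> nat, {in U, forall x, c x < k}
    & {in U &, forall x y, adj x y -> c x != c y}.

Definition omega U : nat := \max_(K : {set G} | clique K && (K \subset U)) #|K|.

Lemma cliqueP K :
  reflect {in K &, forall x y, x != y -> adj x y} (clique K).
Proof.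
apply: (iffP forall_inP) => [h x y xK yK xy|h x xK].
  by move/forall_inP: (h x xK) => /(_ y yK)/implyP; apply.
by apply/forall_inP => y yK; apply/implyP; exact: h.
Qed.

Lemma leq_omega U K : clique K -> K \subset U -> #|K| <= omega U.
Proof. by move=> cK KU; apply: (@leq_bigmax_cond _ _ _ K); rewrite cK KU. Qed.

Lemma omega_witness U : exists K, [/\ clique K, K \subset U & #|K| = omega U].
Proof.
have c0 : clique (set0 : {set G}) && (set0 \subset U).
  by rewrite sub0set andbT; apply/cliqueP => x y; rewrite inE.
have /(_ _)[|K] := @eq_bigmax_cond _
    [pred K : {set G} | clique K && (K \subset U)] (fun K => #|K|).
  by apply/card_gt0P; exists set0.
by rewrite inE => /andP[cK KU] eK; exists K; split => //; rewrite -eK.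
Qed.

Lemma omegaS U V : U \subset V -> omega U <= omega V.
Proof.
by move=> UV; case: (omega_witness U) => K [cK KU <-];
  apply: leq_omega => //; exact: subset_trans UV.
Qed.

Lemma colorable_in_leq U k l : k <= l -> colorable_in U k -> colorable_in U l.
Proof.
by move=> kl [c ck cP]; exists c => // x xU; apply: leq_trans kl; exact: ck.
Qed.

(** A proper colouring is injective on a clique. The colours form a list rather than an initial
    segment, so that a single one can be removed. *)
Lemma clique_leq_colors (c : G -> nat) (s : seq nat) K : clique K ->
  {in K, forall x, c x \in s} -> {in K &, forall x y, adj x y -> c x != c y} ->
  #|K| <= size s.
Proof.
move=> /cliqueP cK cs cP; rewrite cardE -(size_map c).
apply: uniq_leq_size; last first.
  by move=> _ /mapP[x + ->]; rewrite mem_enum => /cs.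
rewrite map_inj_in_uniq ?enum_uniq // => x y; rewrite !mem_enum => xK yK.
move=> cxy; apply/eqP/negPn/negP => xy.
by have := cP x y xK yK (cK x y xK yK xy); rewrite cxy eqxx.
Qed.

Section Reduction.

Variables (U : {set G}) (v : G).
Hypothesis vU : v \in U.
Hypothesis IH : forall W, W \proper U -> colorable_in W (omega W).

Lemma colorable_proper W : W \proper U -> colorable_in W (omega U).
Proof.
move=> WU; apply: colorable_in_leq (IH WU); exact/omegaS/proper_sub.
Qed.

(** Adding [v] to a clique of [U :\ v] gives a larger clique, so deleting [v] lowers the clique
    number and frees a colour for [v]. *)
Lemma colorable_universal :
  {in U, forall x, x != v -> adj v x} -> colorable_in U (omega U).
Proof.
move=> vA; have UvU : U :\ v \proper U by exact: properD1.
have lt : omega (U :\ v) < omega U.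
  have [K [/cliqueP cK KU <-]] := omega_witness (U :\ v).
  have KvU x : x \in K -> (x != v) && (x \in U).
    by move=> /(subsetP KU); rewrite !inE.
  have vK : v \notin K by apply/negP => /KvU; rewrite eqxx.
  rewrite -[#|K|.+1]/(1 + #|K|) -[1]/(true : nat) -vK -cardsU1.
  apply: leq_omega; last first.
    by apply/subsetP => x; rewrite !inE => /orP[/eqP->|/KvU/andP[]].
  apply/cliqueP => x y; rewrite !inE.
  move=> /orP[/eqP->|xK] /orP[/eqP->|yK] xy; rewrite ?eqxx // in xy *.
  - by have /andP[? ?] := KvU _ yK; exact: vA.
  - by have /andP[? ?] := KvU _ xK; rewrite adj_sym; exact: vA.
  - exact: cK.
apply: colorable_in_leq lt _; have [c ck cP] := IH UvU.
have cv x : x \in U -> x != v -> c x < omega (U :\ v).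
  by move=> xU xv; apply: ck; rewrite !inE xv.
exists (fun x => if x == v then omega (U :\ v) else c x).
  by move=> x xU; case: eqVneq => // xv; apply: ltnW; rewrite ltnS cv.
move=> x y xU yU xy; case: (eqVneq x v) => [xv|xv]; case: (eqVneq y v) => [yv|yv].
- by rewrite xv yv adj_irrefl in xy.
- by rewrite gtn_eqF ?cv.
- by rewrite ltn_eqF ?cv.
- by apply: cP; rewrite ?inE ?xv ?yv.
Qed.

Lemma colorable_dominated b : b \in U -> b != v -> ~~ adj v b ->
  {in U, forall x, adj v x -> adj b x} -> colorable_in U (omega U).
Proof.
move=> bU bv vb dom; have [c ck cP] := colorable_proper (properD1 vU).
have inUv x : x \in U -> x != v -> x \in U :\ v.
  by move=> ? ?; rewrite !inE; apply/andP.
exists (fun x => if x == v then c b else c x).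
  by move=> x xU; case: eqVneq => xv; apply: ck; exact: inUv.
move=> x y xU yU xy; case: (eqVneq x v) => [xv|xv]; case: (eqVneq y v) => [yv|yv].
- by rewrite xv yv adj_irrefl in xy.
- by apply: cP; rewrite ?inUv //; apply: dom => //; rewrite -xv.
- rewrite eq_sym; apply: cP; rewrite ?inUv //.
  by apply: dom; rewrite // adj_sym -yv.
- by apply: cP; rewrite ?inUv.
Qed.

(* The colour classes of the centre [v] in optimal colourings of the two sides
   [U :\: V2] and [U :\: V1] form together a stable set that meets every maximum
   clique of [U]. *)
Lemma colorable_star_cutset V1 V2 :
  V1 \subset U -> V2 \subset U -> V1 != set0 -> V2 != set0 ->
  v \notin V1 -> v \notin V2 ->
  {in V1 & V2, forall x y, (x != y) && ~~ adj x y} ->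
  {in U, forall x, [|| x == v, x \in V1, x \in V2 | adj v x]} ->
  colorable_in U (omega U).
Proof.
move=> V1U V2U V1n V2n vV1 vV2 V12 cov.
have prop V : V \subset U -> V != set0 -> U :\: V \proper U.
  move=> VU /set0Pn[x xV]; rewrite properE subsetDl /=; apply/subsetPn; exists x.
    exact: (subsetP VU).
  by rewrite inE xV.
have [c1 c1k c1P] := colorable_proper (prop _ V2U V2n).
have [c2 c2k c2P] := colorable_proper (prop _ V1U V1n).
pose S := [set x in U :\: V2 | c1 x == c1 v] :|:
          [set x in U :\: V1 | c2 x == c2 v].
have v1 : v \in U :\: V2 by rewrite inE vV2.
have v2 : v \in U :\: V1 by rewrite inE vV1.
have vS : v \in S by rewrite !inE vV2 vU eqxx.
have SP x : (x \in S) = (x \in U :\: V2) && (c1 x == c1 v)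
                      || (x \in U :\: V1) && (c2 x == c2 v).
  by rewrite !inE.
(* If [x] and [y] were adjacent, properness of [c1] and [c2] would make both different from [v] and
   non-adjacent to [v]; then [cov] puts [x] in [V1] and [y] in [V2], between which there are no
   edges. *)
have cross x y : x \in U :\: V2 -> c1 x == c1 v ->
    y \in U :\: V1 -> c2 y == c2 v -> ~~ adj x y.
  move=> xU cx yU cy; apply/negP => xy.
  have xv : x != v.
    apply/eqP => xv; rewrite xv in xy; have := c2P _ _ v2 yU xy.
    by rewrite eq_sym cy.
  have yv : y != v.
    by apply/eqP => yv; rewrite yv in xy; have := c1P _ _ xU v1 xy; rewrite cx.
  have nvx : ~~ adj v x.
    by apply/negP => vx; have := c1P _ _ v1 xU vx; rewrite eq_sym cx.
  have nvy : ~~ adj v y.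
    by apply/negP => vy; have := c2P _ _ v2 yU vy; rewrite eq_sym cy.
  move: xU yU; rewrite !inE => /andP[x2 xU] /andP[y1 yU].
  have := cov x xU; rewrite (negbTE xv) (negbTE x2) (negbTE nvx) /= orbF => x1.
  have := cov y yU; rewrite (negbTE yv) (negbTE y1) (negbTE nvy) /= orbF => y2.
  by have := V12 _ _ x1 y2; rewrite xy andbF.
have Sst : {in S &, forall x y, ~~ adj x y}.
  move=> x y; rewrite !SP.
  move=> /orP[/andP[xU cx]|/andP[xU cx]] /orP[/andP[yU cy]|/andP[yU cy]].
  - by apply/negP => /(c1P _ _ xU yU); rewrite (eqP cx) eq_sym cy.
  - exact: cross.
  - by rewrite adj_sym; exact: cross.
  - by apply/negP => /(c2P _ _ xU yU); rewrite (eqP cx) eq_sym cy.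
have SU : S \subset U.
  by apply/subsetP => x; rewrite !inE => /orP[] /andP[] /andP[].
have US : U :\: S \proper U.
  by apply: prop => //; apply/set0Pn; exists v.
(* A clique avoiding [S] misses [V1] or [V2], as no edge joins them. On its side it avoids the
   colour of [v], so one colour fewer than [omega U] suffices for it. *)
have lt : omega (U :\: S) < omega U.
  have [K [cK KU <-]] := omega_witness (U :\: S).
  have side V (c : G -> nat) : v \in U :\: V ->
      {in U :\: V, forall x, c x < omega U} ->
      {in U :\: V &, forall x y, adj x y -> c x != c y} ->
      K \subset U :\: V -> {in K, forall x, c x != c v} -> #|K| < omega U.
    move=> vV ck cP KV Kv.
    have cvi : c v \in iota 0 (omega U) by rewrite mem_iota /= ck.
    have := @clique_leq_colors c (rem (c v) (iota 0 (omega U))) K cK.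
    rewrite size_rem // size_iota => h.
    have oU : 0 < omega U by exact: leq_ltn_trans (ck _ vV).
    rewrite -(prednK oU) ltnS; apply: h.
      move=> x xK; rewrite mem_rem_uniq ?iota_uniq // inE Kv //= mem_iota /= ck //.
      exact: (subsetP KV).
    by move=> x y xK yK; apply: cP; exact: (subsetP KV).
  have KUS x : x \in K -> x \in U /\ x \notin S.
    by move=> /(subsetP KU); rewrite inE => /andP[].
  case: (set_0Vmem (K :&: V2)) => [K2|[y]].
    have KV : K \subset U :\: V2.
      apply/subsetP => x xK; rewrite inE; have [-> _] := KUS _ xK; rewrite andbT.
      apply/negP => x2; have : x \in K :&: V2 by rewrite inE xK.
      by rewrite K2 inE.
    apply: (side V2 c1) => // x xK; apply/negP => cx.
    have [_ /negP] := KUS _ xK; apply.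
    by rewrite SP cx (subsetP KV).
  rewrite inE => /andP[yK y2].
  have KV : K \subset U :\: V1.
    apply/subsetP => x xK; rewrite inE; have [-> _] := KUS _ xK; rewrite andbT.
    apply/negP => x1; have /andP[xy] := V12 _ _ x1 y2.
    by move/cliqueP: cK => /(_ x y xK yK xy) ->.
  apply: (side V1 c2) => // x xK; apply/negP => cx.
  have [_ /negP] := KUS _ xK; apply.
  by rewrite SP orbC cx (subsetP KV).
apply: colorable_in_leq lt _; have [c ck cP] := IH US.
have cW x : x \in U -> x \notin S -> c x < omega (U :\: S).
  by move=> xU xS; apply: ck; rewrite inE xS.
exists (fun x => if x \in S then omega (U :\: S) else c x).
  by move=> x xU; case: ifPn => // xS; apply: ltnW; rewrite ltnS cW.
move=> x y xU yU xy; case: ifPn => xS; case: ifPn => yS.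
- by have := Sst _ _ xS yS; rewrite xy.
- by rewrite gtn_eqF ?cW.
- by rewrite ltn_eqF ?cW.
- by apply: cP; rewrite // inE ?xS ?yS.
Qed.

End Reduction.

Hypothesis P5F : mono_free (path_graph 5) G.
Hypothesis coP5F : mono_free (complement (path_graph 5)) G.
Hypothesis C5F : mono_free C5 G.

Lemma colorable_omega U : colorable_in U (omega U).
Proof.
have [n] := ubnP #|U|; elim: n U => // n IHn U; rewrite ltnS => Un.
have IH W : W \proper U -> colorable_in W (omega W).
  by move=> /proper_card WU; apply: IHn; exact: leq_trans Un.
case: (set_0Vmem U) => [->|[v vU]].
  by exists (fun=> 0) => x; rewrite inE.
pose B := [set x in U | (x != v) && ~~ adj v x].
have BU : B \subset U by apply/subsetP => x; rewrite inE => /andP[].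
have BP x : x \in B -> [/\ x \in U, x != v & ~~ adj v x].
  by rewrite inE => /and3P[].
have vB : v \notin B by rewrite inE eqxx andbF.
have [B0|[b0 b0B]] := set_0Vmem B.
  apply: (colorable_universal vU IH) => x xU xv; apply/negPn/negP => vx.
  by have := in_set0 x; rewrite -B0 inE xU xv vx.
have Bn : B != set0 by apply/set0Pn; exists b0.
(* If a neighbour [a] of [v] has no neighbour in [B], the star at [v] separates [a] from [B]. *)
case: (boolP [exists a in U, adj v a && [forall b in B, ~~ adj a b]]).
  move=> /exists_inP[a aU /andP[va /forall_inP aB]].
  apply: (@colorable_star_cutset U v vU IH [set a] B) => //.
  - by rewrite sub1set.
  - by apply/set0Pn; exists a; rewrite inE.
  - by rewrite inE; apply: contraTneq va => ->; rewrite adj_irrefl.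
  - move=> x y /set1P-> yB; rewrite aB // andbT; apply: contraTneq yB => <-.
    by rewrite inE va !andbF.
  - move=> x xU; rewrite !inE xU /=.
    by case: eqVneq => //= _; case: adj; rewrite ?orbT.
rewrite negb_exists_in => /forall_inP nA.
have aB a : a \in U -> adj v a -> exists2 d, d \in B & adj a d.
  move=> aU va; have := nA a aU; rewrite va /= negb_forall_in.
  by move=> /exists_inP[d dB]; rewrite negbK => ad; exists d.
(* If [a] and [b] are non-adjacent without a common neighbour in [B], let [D] consist of the
   neighbours of [a] in [B] and their neighbours in [B]. Then [b] is outside [D], and an edge [x y]
   leaving [D] within [B] would give an induced path [v, a, d, x, y]; so the star at [v] separates
   [D] from the rest of [B]. *)
case: (boolP [exists a in U, adj v a && [exists b in B,
   ~~ adj a b && [forall d in B, adj a d ==> ~~ adj d b]]]).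
  move=> /exists_inP[a aU /andP[va /exists_inP[b bB /andP[ab /forall_inP abB]]]].
  pose D := [set x in B | [exists d in B, adj a d && ((x == d) || adj d x)]].
  have DB : D \subset B by apply/subsetP => x; rewrite inE => /andP[].
  apply: (@colorable_star_cutset U v vU IH D (B :\: D)).
  - exact: subset_trans BU.
  - by apply: subset_trans BU; exact: subsetDl.
  - have [d dB ad] := aB a aU va; apply/set0Pn; exists d; rewrite inE dB /=.
    by apply/exists_inP; exists d; rewrite // ad eqxx.
  - apply/set0Pn; exists b; rewrite inE bB andbT inE bB /=.
    apply/negP => /exists_inP[d dB /andP[ad /orP[/eqP bd|db]]].
      by rewrite bd ad in ab.
    by have := abB d dB; rewrite ad db.
  - by rewrite inE (negbTE vB).
  - by rewrite inE (negbTE vB) andbF.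
  - move=> x y xD; rewrite inE => /andP[yD yB].
    apply/andP; split; first by apply: contraNneq yD => <-.
    apply/negP => xy; move: xD; rewrite inE.
    move=> /andP[xB /exists_inP[d dB /andP[ad dx]]].
    have yN z : z \in B -> adj a z -> ~~ adj z y.
      move=> zB az; apply/negP => zy; move/negP: yD; apply; rewrite inE yB /=.
      by apply/exists_inP; exists z; rewrite // az zy orbT.
    have ay : ~~ adj a y.
      apply/negP => ay; move/negP: yD; apply; rewrite inE yB /=.
      by apply/exists_inP; exists y; rewrite // ay eqxx.
    have ax : ~~ adj a x by apply/negP => ax; have := yN x xB ax; rewrite xy.
    have {}dx : adj d x.
      by case/orP: dx => // /eqP xd; rewrite xd ad in ax.
    have [_ _ vd] := BP _ dB; have [_ _ vx] := BP _ xB; have [_ _ vy] := BP _ yB.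
    exact: (@P5_freeP _ _ _ _ _ _ P5F va ad dx xy vd vx vy ax ay (yN d dB ad)).
  - move=> x xU; rewrite in_setD; case: (x \in D); rewrite ?orbT //= inE xU /=.
    by case: eqVneq => //= _; case: adj.
rewrite negb_exists_in => /forall_inP nA2.
have dom a b : a \in U -> adj v a -> b \in B -> ~~ adj a b ->
    exists d, [/\ d \in B, adj a d & adj d b].
  move=> aU va bB ab; have := nA2 a aU; rewrite va /= negb_exists_in.
  move=> /forall_inP/(_ b bB); rewrite ab /= negb_forall_in.
  move=> /exists_inP[d dB]; rewrite negb_imply negbK => /andP[ad db].
  by exists d.
pose N b := [set a in U | adj v a && adj b a].
case: (arg_maxnP (fun b => #|N b|) b0B) => b bB bmax.
have [bU bv vb] := BP _ bB.
apply: (@colorable_dominated U v vU IH b) => // a aU va; apply/negPn/negP => ba.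
have ab : ~~ adj a b by rewrite adj_sym.
have [d [dB ad db]] := dom a b aU va bB ab.
have [dU dv vd] := BP _ dB.
(* The vertex [d] sees [a] and [b] does not, so by the choice of [b] some [a'] in [N b] is missed by
   [d]. *)
have : ~~ (N b \subset N d).
  apply/negP => sub; have : #|N b| < #|N d|.
    apply: proper_card; rewrite properE sub /=; apply/subsetPn; exists a.
      by rewrite inE aU va adj_sym.
    by rewrite inE aU va.
  by rewrite ltnNge; move/negP; apply; exact: (bmax d dB).
move=> /subsetPn[a']; rewrite !inE => /and3P[a'U va' ba'].
rewrite a'U va' /= => da'.
(* If [a] and [a'] are adjacent, then [a, b, v, d, a'], in the order of the complementary path, form
   a house; otherwise [v, a, d, b, a'] is an induced C5. *)
case: (boolP (adj a a')) => aa'.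
  apply: (@house_freeP G a b v d a') => //; by rewrite adj_sym.
apply: (@C5_freeP G v a d b a') => //; by rewrite adj_sym.
Qed.

Lemma chromatic_clique_number : chromatic_number G = clique_number G.
Proof.
have oT : omega [set: G] = clique_number G.
  by apply: eq_bigl => K; rewrite subsetT andbT.
rewrite /chromatic_number; case: ex_minnP => k /existsP[c /forallP cP] kmin.
apply/eqP; rewrite eqn_leq; apply/andP; split.
  apply: kmin; rewrite -oT; have [d dk dP] := colorable_omega [set: G].
  apply/existsP; exists [ffun x => Ordinal (dk x (in_setT x))].
  apply/forallP => x; apply/forallP => y; apply/implyP => xy.
  by rewrite !ffunE; apply: dP; rewrite ?inE.
rewrite -oT; have [K [cK _ <-]] := omega_witness [set: G].
rewrite -[k](size_iota 0); apply: (clique_leq_colors (c := fun x => c x)) cK _ _.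
  by move=> x _; rewrite mem_iota /=.
by move=> x y _ _ xy; have /forallP/(_ y)/implyP/(_ xy) := cP x.
Qed.

End Coloring.

Lemma mono_free_perfect (G : sgraph) :
  mono_free (path_graph 5) G -> mono_free (complement (path_graph 5)) G ->
  mono_free C5 G -> perfect G.
Proof.
move=> P5F coP5F C5F S.
have M : {mono (fun x : induced S => val x : G) : x y / adj x y} by [].
by apply: chromatic_clique_number; apply: (mono_free_comp M).
Qed.

(** * Finite facts about the five-cycle *)

Lemma c5adj_ex_nonneighbor (i j : 'I_5) :
  exists k, [&& k != i, k != j & ~~ c5adj i k].
Proof. by ord5 i; ord5 j; ex5. Qed.

Lemma c5adj_ex_neighbor (i j : 'I_5) : exists k, [&& k != i, k != j & c5adj i k].
Proof. by ord5 i; ord5 j; ex5. Qed.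

(** Like the two preceding lemmas, this supplies an index away from a replaced position [j] at which
    two ways of attaching a vertex to a C5 disagree. *)
Lemma c5adj_ex_distinguishing (i i' j : 'I_5) : i' != i ->
  exists k, [&& k != i, k != i', k != j & c5adj i k != c5adj i' k].
Proof. by ord5 i; ord5 i' => //= _; ord5 j; ex5. Qed.

(** Primality of C5: a set with two vertices that absorbs every vertex distinguishing two of its
    members is everything. *)
Lemma c5adj_prime (S : pred 'I_5) (i j : 'I_5) : i != j -> S i -> S j ->
  (forall i j k, S i -> S j -> c5adj k i -> ~~ c5adj k j -> k != j -> S k) ->
  forall k, S k.
Proof.
move=> ij Si Sj H.
(* For each of the five [k], its two neighbours are paired with its two non-neighbours, which gives
   20 instances. *)
have := H (o5 1) (o5 2) (o5 0); have := H (o5 1) (o5 3) (o5 0).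
have := H (o5 4) (o5 2) (o5 0); have := H (o5 4) (o5 3) (o5 0).
have := H (o5 2) (o5 3) (o5 1); have := H (o5 2) (o5 4) (o5 1).
have := H (o5 0) (o5 3) (o5 1); have := H (o5 0) (o5 4) (o5 1).
have := H (o5 3) (o5 4) (o5 2); have := H (o5 3) (o5 0) (o5 2).
have := H (o5 1) (o5 4) (o5 2); have := H (o5 1) (o5 0) (o5 2).
have := H (o5 4) (o5 0) (o5 3); have := H (o5 4) (o5 1) (o5 3).
have := H (o5 2) (o5 0) (o5 3); have := H (o5 2) (o5 1) (o5 3).
have := H (o5 0) (o5 1) (o5 4); have := H (o5 0) (o5 2) (o5 4).
have := H (o5 3) (o5 1) (o5 4); have := H (o5 3) (o5 2) (o5 4).
move: ij Si Sj; elim/ord5_ind: i; elim/ord5_ind: j => //= _ Si Sj;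
  do 20![move=> /(_ _ _ isT isT isT) ?];
  apply: ord5_ind; by auto 8.
Qed.

(** * Homogeneous sets around an induced C5 *)

Section P5HouseFree.

Variable G : sgraph.
Hypothesis P5F : mono_free (path_graph 5) G.
Hypothesis coP5F : mono_free (complement (path_graph 5)) G.
Implicit Types (U X C D : {set G}) (t : C5 -> G).

(** Excluding P5 forbids a single neighbour or just two adjacent ones on the C5; excluding the house
    forbids a single non-neighbour or just two non-adjacent ones. Twelve of the 32 patterns remain.
    In the third case adjacency to [t i] itself is left open. *)
Lemma C5_attachment t v : {mono t : i j / adj i j} ->
  [\/ forall i, adj v (t i), forall i, ~~ adj v (t i)
    | exists i, forall j, j != i -> adj v (t j) = c5adj i j].
Proof.
move=> tM; have tE i j : adj (t i) (t j) = c5adj i j by exact: tM.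
have H1 a b c d : [&& c5adj a b, c5adj b c, c5adj c d, ~~ c5adj a c,
    ~~ c5adj a d & ~~ c5adj b d] ->
    adj v (t a) ==> [|| adj v (t b), adj v (t c) | adj v (t d)].
  move=> /and5P[ab bc cd ac /andP[ad bd]]; apply/implyP => va.
  apply/negPn; rewrite !negb_or; apply/negP => /and3P[vb vc vd].
  by apply: (@P5_freeP G v (t a) (t b) (t c) (t d)); rewrite ?tE.
have H2 a b c d : [&& ~~ c5adj a b, ~~ c5adj b c, ~~ c5adj c d, c5adj a c,
    c5adj a d & c5adj b d] ->
    [&& adj v (t b), adj v (t c) & adj v (t d)] ==> adj v (t a).
  move=> /and5P[ab bc cd ac /andP[ad bd]].
  apply/implyP => /and3P[vb vc vd]; apply/negPn/negP => va.
  by apply: (@house_freeP G v (t a) (t b) (t c) (t d)); rewrite ?tE.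
have := H1 (o5 0) (o5 1) (o5 2) (o5 3) isT.
have := H1 (o5 1) (o5 2) (o5 3) (o5 4) isT.
have := H1 (o5 2) (o5 3) (o5 4) (o5 0) isT.
have := H1 (o5 3) (o5 4) (o5 0) (o5 1) isT.
have := H1 (o5 4) (o5 0) (o5 1) (o5 2) isT.
have := H2 (o5 0) (o5 2) (o5 4) (o5 1) isT.
have := H2 (o5 1) (o5 3) (o5 0) (o5 2) isT.
have := H2 (o5 2) (o5 4) (o5 1) (o5 3) isT.
have := H2 (o5 3) (o5 0) (o5 2) (o5 4) isT.
have := H2 (o5 4) (o5 1) (o5 3) (o5 0) isT.
case E0: (adj v (t (o5 0))); case E1: (adj v (t (o5 1)));
case E2: (adj v (t (o5 2))); case E3: (adj v (t (o5 3)));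
case E4: (adj v (t (o5 4))) => //= _ _ _ _ _ _ _ _ _ _;
  first [ by constructor 1; apply: ord5_ind; rewrite ?(E0, E1, E2, E3, E4)
        | by constructor 2; apply: ord5_ind; rewrite ?(E0, E1, E2, E3, E4)
        | constructor 3;
  first [ by exists (o5 0); apply: ord5_ind; rewrite ?(E0, E1, E2, E3, E4)
        | by exists (o5 1); apply: ord5_ind; rewrite ?(E0, E1, E2, E3, E4)
        | by exists (o5 2); apply: ord5_ind; rewrite ?(E0, E1, E2, E3, E4)
        | by exists (o5 3); apply: ord5_ind; rewrite ?(E0, E1, E2, E3, E4)
        | by exists (o5 4); apply: ord5_ind; rewrite ?(E0, E1, E2, E3, E4) ] ].
Qed.

(** Also known as a module of the subgraph induced by [U]. *)
Definition homogeneous U X : Prop :=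
  {in U :\: X & X &, forall v y z, adj v y = adj v z}.

(* [h] partitions its support into five classes; the edges between distinct
   classes are those of a blown-up [C5], those inside a class are arbitrary. *)
Definition C5_blowup U (h : G -> option 'I_5) : Prop :=
  [/\ forall x, h x -> x \in U,
      forall x y i j, h x = Some i -> h y = Some j -> i != j ->
        adj x y = c5adj i j
    & forall i, exists x, h x == Some i].

(** The induction enlarges the blow-up: an outside vertex distinguishing two of its vertices fits
    into one of the classes. If there is none, the whole blow-up [W h] or a class with two vertices
    is the homogeneous set, unless [U] is just the C5. *)
Lemma C5_blowup_homogeneous U h : C5_blowup U h ->
  #|U| = 5 \/
  exists X, [/\ X \subset U, 1 < #|X|, #|X| < #|U| & homogeneous U X].
Proof.
pose W h := [set x : G | isSome (h x : option 'I_5)].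
have [n] := ubnP (#|U| - #|W h|); elim: n h => // n IHn h; rewrite ltnS => Un.
move=> [hU hA hS]; pose t i := xchoose (hS i).
have ht i : h (t i) = Some i by apply/eqP; exact: (xchooseP (hS i)).
have WU : W h \subset U by apply/subsetP => x; rewrite inE; exact: hU.
have trM t' : (forall i, h (t' i) = Some i) ->
    {mono (t' : C5 -> G) : i j / adj i j}.
  move=> ht' i j; case: (eqVneq i j) => [->|ij]; first by rewrite !adj_irrefl.
  exact: hA.
have tI : injective t by exact: mono_inj C5_point_determining (trM _ ht).
have sub w j : h w = Some j -> forall i, h ([eta t with j |-> w] i) = Some i.
  by move=> hw i /=; case: eqVneq => [->|].
case: (boolP [exists v in U :\: W h, exists x in W h, exists y in W h,
              adj v x != adj v y]).
  move=> /exists_inP[v]; rewrite !inE => /andP[hv vU].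
  move=> /exists_inP[x]; rewrite inE => hx /exists_inP[y]; rewrite inE => hy.
  have {}hv : h v = None by case: (h v) hv.
  (* Exchanging the representative [t j] for any [w] of its class gives another C5, to which
     [C5_attachment] applies; comparing both attachments at an unchanged index shows that they have
     the same type. *)
  have repl w j (tj := [eta t with j |-> w]) : h w = Some j ->
      [\/ adj v w /\ forall i, adj v (tj i), ~~ adj v w /\ forall i, ~~ adj v (tj i)
        | exists i, forall k, k != i -> adj v (tj k) = c5adj i k].
    move=> hw; have tjj : tj j = w by rewrite /= eqxx.
    have [a|a|a] := C5_attachment v (trM _ (sub w j hw)).
    - by constructor 1; split => //; rewrite -tjj.
    - by constructor 2; split => //; rewrite -tjj.
    - by constructor 3.
  have tjE w j k : k != j -> [eta t with j |-> w] k = t k.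
    by move=> /negbTE /= ->.
  have [vt|vt|[i vt]] := C5_attachment v (trM _ ht).
  - have all w : h w -> adj v w.
      case hw: (h w) => [j|//] _.
      have [[]//|[_ a]|[i a]] := repl w j hw.
        have [k /and3P[_ kj _]] := c5adj_ex_neighbor j j.
        by have := a k; rewrite tjE // vt.
      have [k /and3P[ki kj ik]] := c5adj_ex_nonneighbor i j.
      by have := a k ki; rewrite tjE // vt (negbTE ik).
    by rewrite !all.
  - have all w : h w -> ~~ adj v w.
      case hw: (h w) => [j|//] _.
      have [[_ a]|[]//|[i a]] := repl w j hw.
        have [k /and3P[_ kj _]] := c5adj_ex_neighbor j j.
        by have := a k; rewrite tjE // (negbTE (vt k)).
      have [k /and3P[ki kj ik]] := c5adj_ex_neighbor i j.
      by have := a k ki; rewrite tjE // (negbTE (vt k)) ik.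
    by rewrite !(negbTE (all _ _)).
  (* Here [v] sees every class other than [i] as class [i] does, so it can join class [i]. *)
  - have clone w j : h w = Some j -> j != i -> adj v w = c5adj i j.
      move=> hw ji; have [[_ a]|[_ a]|[i' a]] := repl w j hw.
      + have [k /and3P[ki kj ik]] := c5adj_ex_nonneighbor i j.
        by have := a k; rewrite tjE // vt // (negbTE ik).
      + have [k /and3P[ki kj ik]] := c5adj_ex_neighbor i j.
        by have := a k; rewrite tjE // vt // ik.
      + case: (eqVneq i' i) => [ii|ii].
          by have := a j; rewrite /= eqxx ii => ->.
        have [k /and4P[ki ki' kj]] := c5adj_ex_distinguishing j ii.
        by rewrite -(a _ ki') tjE // vt // eqxx.
    move=> _; pose h' x := if x == v then Some i else h x.
    apply: (IHn h'); last split.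
    + apply: leq_trans Un; have vW : v \notin W h by rewrite inE hv.
      have -> : W h' = v |: W h.
        by apply/setP => z; rewrite !inE /h'; case: (z == v).
      have : v |: W h \subset U.
        by apply/subsetP => z /setU1P[->//|]; exact: (subsetP WU).
      move/subset_leq_card; rewrite cardsU1 vW add1n => lt.
      exact: ltn_sub2l.
    + by move=> z; rewrite /h'; case: eqVneq => [->|_ /hU].
    + move=> z w k l; rewrite /h'.
      case: (eqVneq z v) => [->|zv]; case: (eqVneq w v) => [->|wv].
      * by move=> -[->] [->]; rewrite eqxx.
      * by move=> -[<-] hw kl; apply: clone; rewrite // eq_sym.
      * by move=> hz [<-] kl; rewrite adj_sym c5adj_sym; exact: clone.
      * exact: hA.
    + move=> k; exists (t k); rewrite /h'.
      by case: (eqVneq (t k) v) => [tv|_]; [have := ht k; rewrite tv hv | rewrite ht].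
rewrite negb_exists_in => /forall_inP nm.
have Whom : homogeneous U (W h).
  move=> v y z vW yW zW; apply/eqP/negPn/negP => vyz.
  have /negP := nm v vW; apply; apply/exists_inP; exists y => //.
  by apply/exists_inP; exists z.
have tW i : t i \in W h by rewrite inE ht.
have tU i : t i \in U by exact: (subsetP WU).
have imt : #|t @: [set: 'I_5]| = 5 by rewrite card_imset // cardsT card_ord.
have W5 : 4 < #|W h|.
  by rewrite -imt; apply: subset_leq_card; apply/subsetP => _ /imsetP[i _ ->].
move: WU; rewrite subEproper => /orP[/eqP WU|WU]; last first.
  by right; exists (W h); split; [exact: proper_sub | exact: ltn_trans W5
    | exact: proper_card |].
case: (boolP [exists x in U, [exists i, (h x == Some i) && (x != t i)]]) => [|nx].
  move=> /exists_inP[x xU /existsP[i /andP[/eqP hx xt]]]; right.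
  exists [set z | h z == Some i]; split.
  - by apply/subsetP => z; rewrite inE => /eqP hz; rewrite -WU inE hz.
  - rewrite (cardsD1 x) inE hx eqxx /= (cardsD1 (t i)) !inE ht eqxx.
    by rewrite eq_sym xt.
  - have [k /and3P[ki _ _]] := c5adj_ex_neighbor i i.
    apply: proper_card; rewrite properE; apply/andP; split.
      by apply/subsetP => z; rewrite inE => /eqP hz; rewrite -WU inE hz.
    by apply/subsetPn; exists (t k); rewrite // inE ht; apply: contra ki => /eqP[->].
  - move=> v y z; rewrite -WU !inE => /andP[vi]; case hv: (h v) vi => [j|//] ji _.
    move=> /eqP hy /eqP hz.
    have ij : j != i by apply: contra ji => /eqP->.
    by rewrite (hA _ _ _ _ hv hy) // (hA _ _ _ _ hv hz).
left; apply/eqP; rewrite eqn_leq -{2}WU W5 andbT -imt; apply: subset_leq_card.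
apply/subsetP => x xU; have := xU; rewrite -WU inE; case hx: (h x) => [i|//] _.
move: nx; rewrite negb_exists_in => /forall_inP/(_ x xU).
rewrite negb_exists => /forallP/(_ i); rewrite hx eqxx /= negbK => /eqP->.
by rewrite imset_f ?inE.
Qed.

Lemma C5_homogeneous U t : {mono t : i j / adj i j} -> (forall i, t i \in U) ->
  #|U| = 5 \/
  exists X, [/\ X \subset U, 1 < #|X|, #|X| < #|U| & homogeneous U X].
Proof.
move=> tM tU; have tI := mono_inj C5_point_determining tM.
apply: (@C5_blowup_homogeneous U (fun x => [pick i | t i == x])); split.
- by move=> x; case: pickP => // i /eqP <-.
- move=> x y i j; case: pickP => // k /eqP <- [->].
  by case: pickP => // l /eqP <- [->] _; rewrite tM.
- move=> i; exists (t i); case: pickP => [k /eqP/tI->//|/(_ i)].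
  by rewrite eqxx.
Qed.

(** * C5-free sets and substitution *)

(** Quantifying over finite functions makes this a boolean, so that a heaviest C5-free subset can be
    chosen. *)
Definition C5_free_set (C : {set G}) : bool :=
  ~~ [exists t : {ffun 'I_5 -> G},
      [forall i, t i \in C] && [forall i, forall j, adj (t i) (t j) == c5adj i j]].

Lemma C5_free_setP C :
  reflect (forall t, {mono t : i j / adj i j} -> ~ forall i, t i \in C)
    (C5_free_set C).
Proof.
apply: (iffP negP) => [nC t tM tC|nC].
  apply: nC; apply/existsP; exists [ffun i => t i]; apply/andP; split.
    by apply/forallP => i; rewrite ffunE.
  by apply/forallP => i; apply/forallP => j; rewrite !ffunE tM.
move=> /existsP[t /andP[/forallP tC /forallP tM]]; apply: (nC t) => // i j.
by have /forallP/(_ j)/eqP := tM i.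
Qed.

Lemma C5_free_set_card C : #|C| < 5 -> C5_free_set C.
Proof.
move=> C5; apply/C5_free_setP => t tM tC; move: C5; rewrite ltnNge => /negP; apply.
have tI := mono_inj C5_point_determining tM.
rewrite -[5]card_ord -cardsT -(card_imset _ tI); apply: subset_leq_card.
by apply/subsetP => _ /imsetP[i _ ->].
Qed.

Lemma C5_free_set_perfect C : C5_free_set C -> perfect (induced C).
Proof.
move=> /C5_free_setP fC.
have M : {mono (fun x : induced C => val x : G) : x y / adj x y} by [].
apply: mono_free_perfect; try exact: (mono_free_comp M).
by move=> f fM; apply: (fC (fun i => val (f i))) => // i; exact: valP.
Qed.

(* [C5] has no nontrivial homogeneous set, so an induced [C5] meets [X] in at
   most one vertex or lies inside it. *)
Lemma C5_free_set_subst U X x C D : homogeneous U X -> x \in X ->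
  C \subset U -> C :&: X = [set x] -> D \subset X ->
  C5_free_set C -> C5_free_set D -> C5_free_set (C :\: X :|: D).
Proof.
move=> homX xX CU CX DX /C5_free_setP fC /C5_free_setP fD.
apply/C5_free_setP => t tM tCD.
have tE i j : adj (t i) (t j) = c5adj i j by exact: tM.
have tX i : t i \notin X -> (t i \in U :\: X) && (t i \in C).
  move=> tiX; have := tCD i; rewrite !inE tiX /=.
  have -> : (t i \in D) = false.
    by apply: contraNF tiX; exact: (subsetP DX).
  by rewrite orbF => /[dup] /(subsetP CU) -> ->.
case: (boolP [exists i, exists j, [&& i != j, t i \in X & t j \in X]]).
  move=> /existsP[i /existsP[j /and3P[ij iX jX]]].
  apply: (fD t tM) => k; have := tCD k; rewrite !inE.
  suff -> : t k \in X by [].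
  (* No vertex outside [X] distinguishes two vertices of [X], so by primality the whole C5 lies in
     [X], hence in [D]. *)
  apply: (@c5adj_prime (fun k => t k \in X) i j) => // {i j k ij iX jX}.
  move=> i j k iX jX ki kj _; apply/negPn/negP => /tX/andP[kU _].
  by have := homX _ _ _ kU iX jX; rewrite !tE ki (negbTE kj).
rewrite negb_exists => /forallP one.
have xC : x \in C by have := set11 x; rewrite -CX inE => /andP[].
(* At most one vertex of the C5 lies in [X]; by homogeneity [x] can replace it, which gives a C5
   inside [C]. *)
apply: (fC (fun i => if t i \in X then x else t i)) => [i j|i]; last first.
  by case: ifPn => // /tX/andP[].
case: (eqVneq i j) => [->|ij]; first by rewrite !adj_irrefl.
have := one i; rewrite negb_exists => /forallP/(_ j); rewrite ij /= -tE.
case: (boolP (t i \in X)) => iX; case: (boolP (t j \in X)) => jX //= _.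
- have /andP[jU _] := tX _ jX.
  by rewrite ![adj _ (t j)]adj_sym; exact: homX.
- by have /andP[iU _] := tX _ iX; exact: homX.
Qed.

(** * The bound on sums of squares *)

Local Open Scope ring_scope.

Lemma sum_sqr_le_sqr_sum (R : realFieldType) (f : G -> R) (C : {set G}) :
  (forall v, 0 <= f v) -> \sum_(v in C) f v ^+ 2 <= (\sum_(v in C) f v) ^+ 2.
Proof.
move=> f0; pose Q (a b : R) := 0 <= b /\ a <= b ^+ 2.
suff : Q (\sum_(v in C) f v ^+ 2) (\sum_(v in C) f v) by case.
apply: (big_rec2 Q) => [|v a b _ [b0 ab]]; rewrite /Q; first by rewrite expr0n.
by split; [exact: addr_ge0 | have := f0 v; nra].
Qed.

(** Both [f] and [m] vary in the induction: it is applied to [X] with its heaviest C5-free weight as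
    bound, and to the contracted set with new weights. *)
Lemma sum_sqr_le_C5_free (R : realFieldType) (U : {set G}) (f : G -> R) (m : R) :
  (forall v, 0 <= f v) ->
  (forall C, C \subset U -> C5_free_set C -> \sum_(v in C) f v <= m) ->
  \sum_(v in U) f v ^+ 2 <= m ^+ 2.
Proof.
have [n] := ubnP #|U|; elim: n U f m => // n IHn U f m; rewrite ltnS => Un f0 fm.
have f_ge0 (C : {set G}) : 0 <= \sum_(v in C) f v by apply: sumr_ge0.
have sq C : C \subset U -> C5_free_set C -> (\sum_(v in C) f v) ^+ 2 <= m ^+ 2.
  by move=> CU fC; have := fm C CU fC; have := f_ge0 C; nra.
case: (boolP (C5_free_set U)) => [fU|].
  by apply: le_trans (sq _ (subxx _) fU); exact: sum_sqr_le_sqr_sum.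
rewrite negbK => /existsP[t /andP[/forallP tU /forallP tM]].
have {}tM : {mono (t : C5 -> G) : i j / adj i j}.
  by move=> i j; have /forallP/(_ j)/eqP := tM i.
have [U5|[X [XU X1 XltU homX]]] := C5_homogeneous tM tU.
  (* Drop a lightest vertex [u]: the other four form a C5-free set, and the square of their sum
     contains a cross term [2 * f x * f y], which pays for [f u ^+ 2]. *)
  have u0 : t ord0 \in U by [].
  case: (@Order.TotalTheory.arg_minP _ _ _ (t ord0)
    (fun u => u \in U) f u0) => u uU umin.
  have cU : #|U :\ u| = 4%N by move: U5; rewrite (cardsD1 u) uU => -[].
  have fU : C5_free_set (U :\ u) by apply: C5_free_set_card; rewrite cU.
  have [x xU] : exists x, x \in U :\ u by apply/card_gt0P; rewrite cU.
  have cUx : #|U :\ u :\ x| = 3%N by move: cU; rewrite (cardsD1 x) xU => -[].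
  have [y yU] : exists y, y \in U :\ u :\ x by apply/card_gt0P; rewrite cUx.
  apply: le_trans (sq _ (subsetDl _ _) fU).
  rewrite (big_setD1 u) //= (big_setD1 x) //= (big_setD1 y) //=.
  rewrite (big_setD1 x xU) /= (big_setD1 y yU) /=.
  have := sum_sqr_le_sqr_sum (U :\ u :\ x :\ y) f0.
  have := f_ge0 (U :\ u :\ x :\ y).
  set r := \sum_(v in _) f v; set q := \sum_(v in _) f v ^+ 2 => r0 qr.
  have ux : f u <= f x by apply: umin; move: xU; rewrite inE => /andP[].
  have uy : f u <= f y by apply: umin; move: yU; rewrite !inE => /and3P[].
  have := f0 u; have := f0 x; have := f0 y => y0 x0 z0.
  have : f u ^+ 2 <= f x * f y by rewrite expr2; exact: ler_pM.
  by have := mulr_ge0 x0 r0; have := mulr_ge0 y0 r0; have := mulr_ge0 x0 y0; nra.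
have [x xX] : exists x, x \in X by apply/card_gt0P; exact: ltnW.
have p0 : (set0 \subset X) && C5_free_set set0.
  by rewrite sub0set C5_free_set_card ?cards0.
case: (@Order.TotalTheory.arg_maxP _ _ _ set0
  (fun D => (D \subset X) && C5_free_set D) (fun D => \sum_(v in D) f v) p0).
move=> D /andP[DX fD] Dmax; set mX := \sum_(v in D) f v.
have XX : \sum_(v in X) f v ^+ 2 <= mX ^+ 2.
  apply: IHn => //; first exact: leq_trans XltU Un.
  by move=> C CX fC; apply: Dmax; rewrite CX.
pose g v := if v == x then mX else f v.
pose U' := x |: (U :\: X).
have xU : x \in U by exact: (subsetP XU).
have U'U : U' \subset U.
  by apply/subsetP => z; rewrite !inE => /orP[/eqP->|/andP[]].
have gE (C : {set G}) (F : R -> R) : x \notin C ->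
    \sum_(v in C) F (g v) = \sum_(v in C) F (f v).
  move=> xC; apply: eq_bigr => v vC; rewrite /g.
  by case: eqVneq => // vx; rewrite -vx vC in xC.
have xUX : x \notin U :\: X by rewrite inE xX.
have : \sum_(v in U') g v ^+ 2 <= m ^+ 2.
  apply: IHn.
  - apply: leq_trans Un; apply: proper_card; rewrite properE U'U /=.
    have [y] : exists y, y \in X :\ x.
      by apply/card_gt0P; move: X1; rewrite (cardsD1 x) xX.
    rewrite !inE => /andP[yx yX]; apply/subsetPn; exists y.
      exact: (subsetP XU).
    by rewrite !inE (negbTE yx) yX.
  - by move=> v; rewrite /g; case: ifP => // _; exact: f_ge0.
  (* If [C] contains [x], replacing [x] by [D] gives a C5-free subset of [U] whose weight under [f]
     is that of [C] under [g]. *)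
  move=> C CU' fC; case: (boolP (x \in C)) => xC; last first.
    by rewrite (gE C id) //; apply: fm => //; exact: subset_trans U'U.
  have CX : C :&: X = [set x].
    apply/setP => z; rewrite !inE; apply/andP/eqP => [[zC zX]|->//].
    by have := subsetP CU' z zC; rewrite !inE zX => /orP[/eqP|].
  have CD : C :\ x = C :\: X.
    apply/setP => z; rewrite !inE; case: (boolP (z \in C)); rewrite ?andbF // => zC.
    rewrite !andbT; congr (~~ _).
    by move/setP: CX => /(_ z); rewrite !inE zC /= => ->.
  rewrite (big_setD1 x) //= {1}/g eqxx (gE _ id) ?setD11 // CD addrC.
  have disj : [disjoint C :\: X & D].
    rewrite -setI_eq0; apply/eqP/setP => z; rewrite !inE.
    apply/negP => /andP[/andP[zX _] /(subsetP DX)]; exact/negP.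
  have -> : \sum_(v in C :\: X) f v + mX = \sum_(v in C :\: X :|: D) f v.
    by rewrite /mX -bigU //; apply: eq_bigl => z; rewrite !inE.
  have CU : C \subset U by exact: subset_trans U'U.
  apply: fm; last exact: C5_free_set_subst homX xX CU CX DX fC fD.
  rewrite subUset; apply/andP; split.
    by apply: subset_trans CU; exact: subsetDl.
  exact: subset_trans XU.
rewrite /U' big_setU1 //= {1}/g eqxx (gE _ (fun y => y ^+ 2)) //.
rewrite [Y in _ -> Y <= _](big_setID X) /= (setIidPr XU).
by apply: le_trans; rewrite lerD2r.
Qed.

End P5HouseFree.

Local Open Scope ring_scope.

Theorem theorem2p8 (R : realType) (G : sgraph)
    (G_P5_free : induced_free (path_graph 5) G)
    (G_coP5_free : induced_free (complement (path_graph 5)) G) :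
  narrow (2 : R) G.
Proof.
have P5F := induced_free_mono_free P5_point_determining G_P5_free.
have coP5F := induced_free_mono_free coP5_point_determining G_coP5_free.
move=> f [f01 fP].
have f0 v : 0 <= f v by have /andP[] := f01 v.
under eq_bigr => v _ do rewrite powR_mulrn //.
(* The bound 1 is written as a square, to take [m = 1]. *)
rewrite -[leRHS](expr1n _ 2).
rewrite (eq_bigl [in [set: G]]) => [|v]; last by rewrite inE.
apply: sum_sqr_le_C5_free => // C _ fC.
exact: fP (C5_free_set_perfect P5F coP5F fC).
Qed.
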